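(* Let $\{\sigma_i:i\in\Lambda\}$ be a semibranching function system with coding map $\sigma$ on a probability measure space $(X,m)$, satisfying condition (C-K), and let $\widetilde A$ be the associated $0$-$1$ matrix. Let $m'$ be another probability measure on $X$ equivalent to $m$. For $\mu\in\{m,m'\}$ let $\pi(\mu)$ be the representation of $\mathcal O_{\widetilde A}$ on $L^2(X,\mu)$ generated by the operators $$(T_i(\mu)\xi)(x)=\chi_{R_i}(x)\,\rho_\mu(\sigma(x),\sigma_i)^{-1/2}\,\xi(\sigma(x)),\qquad i\in\Lambda,\ \xi\in L^2(X,\mu).$$ Then the representations $\pi(m)$ and $\pi(m')$ of $\mathcal O_{\widetilde A}$ are (unitarily) equivalent.
   Context: Semibranching function system (s.f.s.). Let $(X,m)$ be a probability space with $m$ non-atomic. A finite family $\{\sigma_i:i\in\Lambda\}$ of one-to-one measurable maps $\sigma_i$, with $\sigma_i$ defined on a measurable $D_i\subset X$ and with (measurable) range $R_i=\sigma_i(D_i)$, is an s.f.s. if: (i) $m(R_i\cap R_j)=0$ for $i\ne j$ and $m(X\setminus\bigcup_i R_i)=0$; (ii) $m\circ\sigma_i\ll m$ on $D_i$ (where $(m\circ\sigma_i)(C)=m(\sigma_i(C))$) and $\rho_m(x,\sigma_i):=\frac{d\,m\circ\sigma_i}{dm}(x)>0$ for $m$-a.e. $x\in D_i$; (iii) there is a measurable map $\sigma:X\to X$ (the coding map) with $\sigma\circ\sigma_i(x)=x$ for $m$-a.e. $x\in D_i$, for every $i\in\Lambda$. It is saturated if $\bigcup_i D_i=X$ a.e.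 Condition (C-K), which is defined for saturated s.f.s., means: for each $i$ there is $\Lambda_i\subset\Lambda$ with $D_i=\bigcup_{j\in\Lambda_i}R_j$ a.e.; it then defines the $0$-$1$ matrix $\widetilde A=(\widetilde a_{i,j})_{i,j\in\Lambda}$ by $\widetilde a_{i,j}=1\iff j\in\Lambda_i$. Cuntz-Krieger algebra. For a $0$-$1$ matrix $A=(a_{i,j})$, $\mathcal O_A$ is the $C^*$-algebra generated by partial isometries $S_i$ with $\sum_i S_iS_i^*=1$ and $S_i^*S_i=\sum_j a_{i,j}S_jS_j^*$. A family of operators on a Hilbert space satisfying these relations determines a representation of $\mathcal O_A$; operators $T_i(\mu)$ given by the displayed formula satisfy them for $\widetilde A$. Two representations determined by $\{T_i\}$ on $H$ and $\{T'_i\}$ on $H'$ are equivalent if there is a unitary $U:H'\to H$ with $UT'_i=T_iU$ for all $i$. *)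

(* Defs.v *)
From HB Require Import structures.
From mathcomp Require Import all_boot all_order all_algebra.
From mathcomp Require Import generic_quotient ring_quotient sesquilinear.
From mathcomp Require Import all_classical all_reals all_analysis.
From mathcomp Require Import measurable_realfun complex ring lra.

Set Implicit Arguments.
Unset Strict Implicit.
Unset Printing Implicit Defensive.

Import Order.TTheory GRing.Theory Num.Theory.
Import numFieldNormedType.Exports.
Import ComplexField.

Local Open Scope classical_set_scope.
Local Open Scope ring_scope.
Local Open Scope complex_scope.
Local Open Scope quotient_scope.
Local Open Scope charge_scope.

(** * Complex L2 spaces *)

Section SquareIntegrable.
Context {R : realType} d {X : measurableType d}.
Variable mu : {measure set X -> \bar R}.

Definition square_integrable (f : X -> R[i]) : Prop :=
  [/\ measurable_fun [set: X] (fun x => complex.Re (f x)),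
      measurable_fun [set: X] (fun x => complex.Im (f x)) &
      (\int[mu]_x (Normc.normc (f x) ^+ 2)%:E < +oo)%E].

Definition sqint : {pred X -> R[i]} := fun f => `[< square_integrable f >].

Lemma sqintP f :
  (f \in sqint) <-> ((fun x => complex.Re (f x)) \in Lfun mu 2%:E) /\
                    ((fun x => complex.Im (f x)) \in Lfun mu 2%:E).
Proof.
have normcE (z : R[i]) : Normc.normc z ^+ 2 = complex.Re z ^+ 2 + complex.Im z ^+ 2.
  by case: z => a b /=; rewrite sqr_sqrtr// addr_ge0// sqr_ge0.
have LP (a : X -> R) : measurable_fun [set: X] a ->
    (\int[mu]_x (a x ^+ 2)%:E < +oo)%E -> a \in Lfun mu 2%:E.
  move=> ma ia; rewrite inE; apply/andP; split; rewrite inE//=.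
  rewrite /finite_norm unlock poweR_lty//.
  under eq_integral.
    move=> x _; rewrite /= powR_mulrn// real_normK ?num_real//.
    over.
  exact: ia.
rewrite /sqint; split.
  move=> /asboolP[mre mim]; under eq_integral do rewrite normcE EFinD.
  rewrite ge0_integralD//; last 4 first.
  - by move=> x _; rewrite lee_fin sqr_ge0.
  - by apply/measurable_EFinP; exact: measurable_funX.
  - by move=> x _; rewrite lee_fin sqr_ge0.
  - by apply/measurable_EFinP; exact: measurable_funX.
  move=> h; split; apply: LP => //; apply: le_lt_trans h.
    by rewrite leeDl// integral_ge0// => x _; rewrite lee_fin sqr_ge0.
  by rewrite leeDr// integral_ge0// => x _; rewrite lee_fin sqr_ge0.
move=> [Lre Lim]; apply/asboolP.
have mre : measurable_fun [set: X] (fun x => complex.Re (f x)).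
  by move: Lre; rewrite inE => /andP[/[!inE]].
have mim : measurable_fun [set: X] (fun x => complex.Im (f x)).
  by move: Lim; rewrite inE => /andP[/[!inE]].
split => //.
under eq_integral do rewrite normcE EFinD.
rewrite ge0_integralD//; last 4 first.
- by move=> x _; rewrite lee_fin sqr_ge0.
- by apply/measurable_EFinP; exact: measurable_funX.
- by move=> x _; rewrite lee_fin sqr_ge0.
- by apply/measurable_EFinP; exact: measurable_funX.
by apply: lte_add_pinfty; apply: integrable_lty => //;
  exact: Lfun2_integrable_sqr.
Qed.

Lemma sqint_submod_closed : submod_closed sqint.
Proof.
have le12 : (1 <= 2%:E :> \bar R)%E by rewrite lee_fin ler1n.
have [L0 LDZ] := @Lfun_submod_closed _ _ R mu 2%:E le12.
split.
  by apply/sqintP; split; exact: L0.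
move=> a f g /sqintP[fr fi] /sqintP[gr gi]; apply/sqintP; split.
- rewrite (_ : (fun _ => _) = complex.Re a *: (fun x => complex.Re (f x)) +
     ((- complex.Im a) *: (fun x => complex.Im (f x)) +
      (fun x => complex.Re (g x)))); last first.
    apply/funext => x; rewrite /= !fctE.
    by case: a (f x) (g x) => [? ?] [? ?] [? ?] /=; rewrite /GRing.scale /= mulNr addrA.
  by apply: (LDZ) => //; apply: (LDZ).
- rewrite (_ : (fun _ => _) = complex.Re a *: (fun x => complex.Im (f x)) +
     (complex.Im a *: (fun x => complex.Re (f x)) +
      (fun x => complex.Im (g x)))); last first.
    apply/funext => x; rewrite /= !fctE.
    by case: a (f x) (g x) => [? ?] [? ?] [? ?] /=; rewrite /GRing.scale /= addrA.
  by apply: (LDZ) => //; apply: (LDZ).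
Qed.

HB.instance Definition _ :=
  GRing.isSubmodClosed.Build _ _ sqint sqint_submod_closed.

Record L2fun := MkL2fun { l2val :> X -> R[i]; l2valP : l2val \in sqint }.

HB.instance Definition _ := [isSub for l2val].
HB.instance Definition _ := [Choice of L2fun by <:].
HB.instance Definition _ := [SubChoice_isSubLmodule of L2fun by <:].

Lemma l2valD (f g : L2fun) x : (f + g) x = f x + g x.
Proof. by []. Qed.

Lemma l2valB (f g : L2fun) x : (f - g) x = f x - g x.
Proof. by []. Qed.

Lemma l2valZ (a : R[i]) (f : L2fun) x : (a *: f) x = a * f x.
Proof. by []. Qed.

Definition l2null : {pred L2fun} :=
  fun f => `[< {ae mu, forall x, f x = 0} >].

Lemma l2null_submod_closed : submod_closed l2null.
Proof.
split; first by apply/asboolP; apply: nearW.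
move=> a f g /asboolP f0 /asboolP g0; apply/asboolP.
by apply: filterS2 f0 g0 => x fx gx; rewrite l2valD l2valZ fx gx mulr0 addr0.
Qed.

HB.instance Definition _ :=
  GRing.isSubmodClosed.Build _ _ l2null l2null_submod_closed.

Definition L2 : Type := Quotient.quot l2null.
HB.instance Definition _ := GRing.Zmodule.on L2.
HB.instance Definition _ := EqQuotient.on L2.

Lemma L2_eqP (f g : L2fun) :
  reflect {ae mu, forall x, f x = g x} (\pi_L2 f == \pi_L2 g).
Proof.
rewrite (_ : (_ == _) = (f - g \in l2null)); last by rewrite Quotient.idealrBE.
apply: (iffP (asboolP _)); apply: filterS => x.
  by rewrite l2valB => /eqP; rewrite subr_eq0 => /eqP.
by move=> fg; rewrite l2valB fg subrr.
Qed.

Definition l2scale (a : R[i]) (u : L2) : L2 := \pi_L2 (a *: repr u).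

Lemma pi_l2scale a (f : L2fun) : l2scale a (\pi_L2 f) = \pi_L2 (a *: f).
Proof.
apply/eqP/L2_eqP; have /eqP/L2_eqP : \pi_L2 (repr (\pi_L2 f)) = \pi_L2 f.
  exact: reprK.
by apply: filterS => x; rewrite !l2valZ => ->.
Qed.

Lemma pi_L2D (f g : L2fun) : \pi_L2 f + \pi_L2 g = \pi_L2 (f + g).
Proof. by rewrite piE. Qed.

Lemma L2_ind (P : L2 -> Prop) : (forall f : L2fun, P (\pi_L2 f)) -> forall u, P u.
Proof. by move=> h u; rewrite -[u]reprK. Qed.

Let l2scaleA a b u : l2scale a (l2scale b u) = l2scale (a * b) u.
Proof. by elim/L2_ind: u => f; rewrite !pi_l2scale scalerA. Qed.

Let l2scale1 : left_id 1 l2scale.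
Proof. by elim/L2_ind => f; rewrite pi_l2scale scale1r. Qed.

Let l2scaleDr : right_distributive l2scale +%R.
Proof.
move=> a; elim/L2_ind => f; elim/L2_ind => g.
by rewrite pi_L2D !pi_l2scale pi_L2D scalerDr.
Qed.

Let l2scaleDl u : {morph l2scale^~ u : a b / a + b}.
Proof.
by move=> a b; elim/L2_ind: u => f; rewrite !pi_l2scale pi_L2D scalerDl.
Qed.

HB.instance Definition _ := GRing.Zmodule_isLmodule.Build R[i] L2
  l2scaleA l2scale1 l2scaleDr l2scaleDl.

Lemma pi_L2Z a (f : L2fun) : a *: \pi_L2 f = \pi_L2 (a *: f).
Proof. exact: pi_l2scale. Qed.

(** Linear in the first argument, conjugate-linear in the second, as required by
    the interface of forms [{dot _ for Num.conj}]. *)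
Definition cdot (f g : X -> R[i]) : R[i] :=
  (\int[mu]_x complex.Re (f x * (g x)^*)) +i*
  (\int[mu]_x complex.Im (f x * (g x)^*)).

Lemma l2_integrable (f g : L2fun) :
  mu.-integrable setT (EFin \o (fun x => complex.Re (f x * (g x)^*))) /\
  mu.-integrable setT (EFin \o (fun x => complex.Im (f x * (g x)^*))).
Proof.
have [/sqintP[fr fi] /sqintP[gr gi]] := (l2valP f, l2valP g).
have le12 : (1 <= 1%:E :> \bar R)%E by [].
have [_ LDZ] := @Lfun_submod_closed _ _ R mu 1%:E le12.
split; apply/Lfun1_integrable.
- rewrite (_ : (fun _ => _) =
    1 *: ((fun x => complex.Re (f x)) \* (fun x => complex.Re (g x))) +
    ((fun x => complex.Im (f x)) \* (fun x => complex.Im (g x)))).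
    by apply: (LDZ); exact: Lfun2_mul_Lfun1.
  apply/funext => x; rewrite scale1r !fctE /=.
  by case: (l2val f x) (l2val g x) => [? ?] [? ?] /=; ring.
- rewrite (_ : (fun _ => _) =
    (-1) *: ((fun x => complex.Re (f x)) \* (fun x => complex.Im (g x))) +
    ((fun x => complex.Im (f x)) \* (fun x => complex.Re (g x)))).
    by apply: (LDZ); exact: Lfun2_mul_Lfun1.
  apply/funext => x; rewrite scaleN1r !fctE /=.
  by case: (l2val f x) (l2val g x) => [? ?] [? ?] /=; ring.
Qed.

Lemma eq_cdot (f f' g g' : L2fun) : {ae mu, forall x, f x = f' x} ->
  {ae mu, forall x, g x = g' x} -> cdot f g = cdot f' g'.
Proof.
move=> ff' gg'; have [[ir ii] [ir' ii']] := (l2_integrable f g, l2_integrable f' g').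
have [[mr _] [mi _]] := (integrableP _ _ _ ir, integrableP _ _ _ ii).
have [[mr' _] [mi' _]] := (integrableP _ _ _ ir', integrableP _ _ _ ii').
rewrite /cdot /Rintegral; congr (fine _ +i* fine _).
  apply: ae_eq_integral => //.
  by apply: filterS2 ff' gg' => x /= -> -> _.
apply: ae_eq_integral => //.
by apply: filterS2 ff' gg' => x /= -> -> _.
Qed.

Lemma cdotDl (f g h : L2fun) a : cdot (a *: f + g) h = a * cdot f h + cdot g h.
Proof.
have [[ifr ifi] [igr igi]] := (l2_integrable f h, l2_integrable g h).
have iZ (k : R) (u : X -> R) : mu.-integrable setT (EFin \o u) ->
    mu.-integrable setT (EFin \o (fun x => k * u x)).
  by move=> iu; exact: (integrableZl measurableT k iu).
have iD (u v : X -> R) : mu.-integrable setT (EFin \o u) ->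
    mu.-integrable setT (EFin \o v) ->
    mu.-integrable setT (EFin \o (fun x => u x + v x)).
  by move=> iu iv; exact: (integrableD measurableT iu iv).
rewrite /cdot; set Fr := \int[mu]_x complex.Re (f x * _);
  set Fi := \int[mu]_x complex.Im (f x * _).
set Gr := \int[mu]_x complex.Re (g x * _); set Gi := \int[mu]_x complex.Im (g x * _).
rewrite (_ : a * (Fr +i* Fi) + (Gr +i* Gi) =
  (complex.Re a * Fr + ((- complex.Im a) * Fi + Gr)) +i*
  (complex.Re a * Fi + (complex.Im a * Fr + Gi))); last first.
  by case: (a) => ? ? /=; congr (_ +i* _); rewrite ?mulNr addrA.
congr (_ +i* _).
- rewrite -(RintegralZl _ measurableT ifr) -(RintegralZl _ measurableT ifi).
  rewrite -(RintegralD measurableT (iZ _ _ ifi) igr).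
  rewrite -(RintegralD measurableT (iZ _ _ ifr) (iD _ _ (iZ _ _ ifi) igr)).
  apply: eq_Rintegral => x _; rewrite l2valD l2valZ.
  by case: (a) (l2val f x) (l2val g x) (l2val h x) => [? ?] [? ?] [? ?] [? ?] /=; ring.
- rewrite -(RintegralZl _ measurableT ifr) -(RintegralZl _ measurableT ifi).
  rewrite -(RintegralD measurableT (iZ _ _ ifr) igi).
  rewrite -(RintegralD measurableT (iZ _ _ ifi) (iD _ _ (iZ _ _ ifr) igi)).
  apply: eq_Rintegral => x _; rewrite l2valD l2valZ.
  by case: (a) (l2val f x) (l2val g x) (l2val h x) => [? ?] [? ?] [? ?] [? ?] /=; ring.
Qed.

Lemma cdotC (f g : L2fun) : cdot f g = (cdot g f)^*.
Proof.
have [_ igi] := l2_integrable g f.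
rewrite /cdot /= -[X in _ = _ +i* X]mulN1r -(RintegralZl _ measurableT igi).
by congr (_ +i* _); apply: eq_Rintegral => x _;
  case: (l2val f x) (l2val g x) => [? ?] [? ?] /=; ring.
Qed.

Definition l2dot (u v : L2) : R[i] := cdot (repr u) (repr v).

Lemma pi_l2dot (f g : L2fun) : l2dot (\pi_L2 f) (\pi_L2 g) = cdot f g.
Proof. by apply: eq_cdot; apply/L2_eqP/eqP; exact: reprK. Qed.

Lemma l2dotDl a u v w : l2dot (a *: u + v) w = a * l2dot u w + l2dot v w.
Proof.
elim/L2_ind: u => f; elim/L2_ind: v => g; elim/L2_ind: w => h.
by rewrite pi_L2Z pi_L2D !pi_l2dot cdotDl.
Qed.

Lemma l2dotC u v : l2dot u v = Num.conj (l2dot v u).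
Proof. exact: cdotC. Qed.

Lemma l2dot_gt0 u : u != 0 -> 0 < l2dot u u.
Proof.
elim/L2_ind: u => f; have [ir _] := l2_integrable f f.
have q0 x : 0 <= complex.Re (f x * (f x)^*).
  by case: (l2val f x) => a b /=; rewrite mulrN opprK addr_ge0// -expr2 sqr_ge0.
have f0 : (0 : L2) = \pi_L2 0 by rewrite piE.
rewrite f0 pi_l2dot => /L2_eqP nf; rewrite /cdot ltcE/=; apply/andP; split.
  rewrite [X in X == _](_ : _ = \int[mu]_x (0 : R)); last first.
    by apply: eq_Rintegral => x _; case: (l2val f x) => a b /=; ring.
  by rewrite /Rintegral integral0.
rewrite lt_neqAle Rintegral_ge0 ?andbT//; apply/eqP => I0; apply: nf.
have E0 : (\int[mu]_x `|(complex.Re (f x * (f x)^*))%:E| = 0)%E.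
  under eq_integral do rewrite gee0_abs ?lee_fin//.
  by rewrite -[LHS]fineK ?integrable_fin_num//; congr EFin; rewrite I0.
have [mr _] := integrableP _ _ _ ir.
move: E0 => /(ae_eq_integral_abs mu measurableT mr).
apply: filterS => x /(_ I)[]; case: (l2val f x) => a b /= => /eqP.
rewrite mulrN opprK -!expr2 paddr_eq0 ?sqr_ge0// !sqrf_eq0.
by move=> /andP[/eqP -> /eqP ->].
Qed.

Let l2dot_zmodl w : zmod_morphism (l2dot^~ w).
Proof.
by move=> u v; rewrite -[u - v]addrC -scaleN1r l2dotDl mulN1r addrC.
Qed.

Let l2dot_scall w : scalable_for *%R (l2dot^~ w).
Proof.
move=> a u; have := l2dot_zmodl w 0 0; rewrite !subrr => l0.
by rewrite -[a *: u]addr0 l2dotDl l0 addr0.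
Qed.

Let l2dot_zmodr w : zmod_morphism (l2dot w).
Proof.
by move=> u v; rewrite l2dotC l2dot_zmodl rmorphB/= -!l2dotC.
Qed.

Let l2dot_scalr w : scalable_for (Num.conj \; *%R) (l2dot w).
Proof.
by move=> a u; rewrite l2dotC l2dot_scall rmorphM/= -l2dotC.
Qed.

HB.instance Definition _ := @isBilinear.Build R[i] L2 L2 R[i] *%R
  (Num.conj \; *%R) l2dot l2dot_zmodl l2dot_zmodr l2dot_scall l2dot_scalr.

Let l2dot_herm u v : l2dot u v = (-1) ^+ false * Num.conj (l2dot v u).
Proof. by rewrite expr0 mul1r l2dotC. Qed.

HB.instance Definition _ :=
  @isHermitianSesquilinear.Build R[i] L2 false Num.conj l2dot l2dot_herm.
HB.instance Definition _ := @isDotProduct.Build R[i] L2 l2dot l2dot_gt0.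

End SquareIntegrable.

Arguments L2 {R d X} mu.
Arguments L2fun {R d X} mu.
Arguments l2dot {R d X} mu.

(** * Representations of Cuntz-Krieger algebras *)

Section CuntzKrieger.
Context {R : realType} {L : finType}.

Definition adjoint_of (H : lmodType R[i]) (dot : {dot H for Num.conj})
    (S Sstar : H -> H) : Prop :=
  forall u v : H, dot (S u) v = dot u (Sstar v).

Definition bounded_operator (H : lmodType R[i]) (dot : {dot H for Num.conj})
    (S : H -> H) : Prop :=
  linear S /\ exists M : R[i], forall u : H, dot (S u) (S u) <= M * dot u u.

(** By universality of O_A, a representation of O_A is given by the images [S i]
    of its generators, i.e. by partial isometries satisfying the Cuntz-Krieger
    relations of the 0-1 matrix [A]. Completeness of [H] plays no role in these
    definitions, which are applied to the Hilbert spaces [L2 mu]. *)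
Definition CK_representation (A : L -> L -> bool)
    (H : lmodType R[i]) (dot : {dot H for Num.conj}) (S : L -> H -> H) : Prop :=
  (forall i, bounded_operator dot (S i)) /\
  exists Sstar : L -> H -> H,
    [/\ forall i, adjoint_of dot (S i) (Sstar i),
        forall i u, S i (Sstar i (S i u)) = S i u,
        forall u, \sum_(i : L) S i (Sstar i u) = u &
        forall i u, Sstar i (S i u) =
                    \sum_(j : L) (A i j)%:R *: S j (Sstar j u)].

Definition unitary (H' H : lmodType R[i]) (dot' : {dot H' for Num.conj})
    (dot : {dot H for Num.conj}) (U : H' -> H) : Prop :=
  [/\ linear U, isometry dot dot' U & bijective U].

Definition unitarily_equivalent (H H' : lmodType R[i])
    (dot : {dot H for Num.conj}) (dot' : {dot H' for Num.conj})
    (S : L -> H -> H) (S' : L -> H' -> H') : Prop :=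
  exists U : H' -> H, unitary dot' dot U /\
    forall i u, U (S' i u) = S i (U u).

End CuntzKrieger.

(** * Semibranching function systems *)

(** The maps are total functions of which only the values on the domains matter.
    Images of measurable sets are required to be measurable, as is implicit in
    considering the measures m o sigma_i. *)
Record branch_maps d (X : measurableType d) (L : finType) := BranchMaps {
  bdom : L -> set X;
  bmap : L -> X -> X;
  measurable_bdom : forall i, measurable (bdom i);
  measurable_bmap : forall i, measurable_fun (bdom i) (bmap i);
  bmap_inj : forall i, set_inj (bdom i) (bmap i);
  measurable_bimage : forall i (C : set X), measurable C -> C `<=` bdom i ->
    measurable (bmap i @` C)
}.

Definition brange d (X : measurableType d) (L : finType)
  (F : branch_maps X L) (i : L) : set X := bmap F i @` bdom F i.

Section BranchMeasure.
Context {R : realType} d {X : measurableType d} {L : finType}.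
Variables (mu : probability X R) (F : branch_maps X L) (i : L).

(** The measure mu o sigma_i on D_i, extended by zero outside D_i, so that its
    Radon-Nikodym derivative on X restricts to the one on D_i. *)
Definition branch_measure (C : set X) : \bar R :=
  mu (bmap F i @` (C `&` bdom F i)).

Let m_im (C : set X) : measurable C -> measurable (bmap F i @` (C `&` bdom F i)).
Proof.
move=> mC; apply: measurable_bimage; last exact: subIsetr.
by apply: measurableI => //; exact: measurable_bdom.
Qed.

Let branch_measure0 : branch_measure set0 = 0%E.
Proof. by rewrite /branch_measure set0I image_set0 measure0. Qed.

Let branch_measure_ge0 C : (0 <= branch_measure C)%E.
Proof. exact: measure_ge0. Qed.

Let branch_measure_sigma_additive : semi_sigma_additive branch_measure.
Proof.
move=> C mC tC mUC; rewrite /branch_measure setI_bigcupl image_bigcup.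
apply: measure_semi_sigma_additive.
- by move=> n; exact: m_im.
- apply/trivIsetP => n k _ _ nk; rewrite -subset0 => _ [[x [Cx Dx] <-]].
  move=> [y [Cy Dy] yx]; have xy : y = x by apply: bmap_inj yx; exact/mem_set.
  move/trivIsetP : tC => /(_ n k I I nk); rewrite -subset0; move=> /(_ x); apply; split=> //.
  by rewrite -xy.
- rewrite -image_bigcup -setI_bigcupl; exact: m_im.
Qed.

HB.instance Definition _ := isMeasure.Build _ X R branch_measure
  branch_measure0 branch_measure_ge0 branch_measure_sigma_additive.

Let branch_measure_fin : fin_num_fun branch_measure.
Proof. by move=> C mC; apply: fin_num_measure; exact: m_im. Qed.

HB.instance Definition _ := @Measure_isFinite.Build _ X R branch_measure
  branch_measure_fin.

Definition branch_density : X -> \bar R :=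
  'd (charge_of_finite_measure branch_measure) '/d mu.

End BranchMeasure.

Section SemibranchingFunctionSystem.
Context {R : realType} d {X : measurableType d} {L : finType}.
Implicit Types (mu : probability X R) (F : branch_maps X L) (sigma : X -> X).

Definition non_atomic mu : Prop :=
  forall A, measurable A -> (0 < mu A)%E ->
    exists B, [/\ measurable B, B `<=` A & (0 < mu B < mu A)%E].

Record is_sfs mu F sigma : Prop := IsSfs {
  sfs_disjoint : forall i j, i != j -> mu (brange F i `&` brange F j) = 0%E;
  sfs_cover : mu (~` \bigcup_i brange F i) = 0%E;
  sfs_dominates : forall i, branch_measure mu F i `<< mu;
  sfs_density_gt0 : forall i,
    {ae mu, forall x, bdom F i x -> (0 < branch_density mu F i x)%E};
  sfs_coding_measurable : measurable_fun [set: X] sigma;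
  sfs_coding : forall i, {ae mu, forall x, bdom F i x -> sigma (bmap F i x) = x}
}.

Definition saturated mu F : Prop := mu (~` \bigcup_i bdom F i) = 0%E.

Definition condition_CK mu F (Lam : L -> {set L}) : Prop :=
  saturated mu F /\
  forall i, {ae mu, forall x,
    bdom F i x <-> (\bigcup_(j in [set j | j \in Lam i]) brange F j) x}.

Definition CK_matrix (Lam : L -> {set L}) : L -> L -> bool :=
  fun i j => j \in Lam i.

Definition branch_fun mu F sigma (i : L) (xi : X -> R[i]) (x : X) : R[i] :=
  (\1_(brange F i) x * fine (branch_density mu F i (sigma x)) `^ (- 2^-1))%:C
  * xi (sigma x).

(** The operator T_i(mu): the class of [branch_fun] of a representative, with the
    junk value 0 should this not be square integrable. See [branch_opE]. *)
Definition branch_op mu F sigma (i : L) (u : L2 mu) : L2 mu :=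
  \pi_(L2 mu) (insubd 0 (branch_fun mu F sigma i (repr u))).

Definition equivalent_measures (mu nu : probability X R) : Prop :=
  mu `<< nu /\ nu `<< mu.

Lemma measurable_branch_fun mu F sigma i (xi : L2fun mu) :
    is_sfs mu F sigma ->
  measurable_fun setT (fun x => complex.Re (branch_fun mu F sigma i xi x)) /\
  measurable_fun setT (fun x => complex.Im (branch_fun mu F sigma i xi x)).
Proof.
move=> S; have ms := sfs_coding_measurable S.
have /asboolP[mr mi _] := l2valP xi.
have mw : measurable_fun setT (fun x => \1_(brange F i) x *
    fine (branch_density mu F i (sigma x)) `^ (- 2^-1) : R).
  apply: measurable_funM.
    by apply: measurable_indic; apply: measurable_bimage => //; exact: measurable_bdom.
  apply: (@measurableT_comp _ _ _ _ _ _ (fun r : R => r `^ (- 2^-1))) => //.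
  apply: (@measurableT_comp _ _ _ _ _ _ (fun x : X => fine (branch_density mu F i x))) => //.
  apply: measurableT_comp => //.
  apply: (measurable_int mu).
  by apply: Radon_Nikodym_integrable; exact: (sfs_dominates S i).
split.
- rewrite (_ : (fun _ => _) = (fun x => (\1_(brange F i) x *
    fine (branch_density mu F i (sigma x)) `^ (- 2^-1)) * complex.Re (xi (sigma x)))).
    by apply: measurable_funM => //; exact: (measurableT_comp mr ms).
  by apply/funext => x; rewrite /branch_fun; case: (l2val xi (sigma x)) => a b /=; ring.
- rewrite (_ : (fun _ => _) = (fun x => (\1_(brange F i) x *
    fine (branch_density mu F i (sigma x)) `^ (- 2^-1)) * complex.Im (xi (sigma x)))).
    by apply: measurable_funM => //; exact: (measurableT_comp mi ms).
  by apply/funext => x; rewrite /branch_fun; case: (l2val xi (sigma x)) => a b /=; ring.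
Qed.

Lemma branch_fun_ae mu F sigma i (xi eta : X -> R[i]) :
    is_sfs mu F sigma -> {ae mu, forall x, xi x = eta x} ->
  {ae mu, forall x, branch_fun mu F sigma i xi x = branch_fun mu F sigma i eta x}.
Proof.
move=> S [Z [mZ Z0 Zsub]]; have [N [mN N0 Nsub]] := sfs_coding S i.
have mI (C : set X) : measurable C -> measurable (bmap F i @` (C `&` bdom F i)).
  move=> mC; apply: measurable_bimage; last exact: subIsetr.
  by apply: measurableI => //; exact: measurable_bdom.
have I0 (C : set X) : measurable C -> mu C = 0%E ->
    mu (bmap F i @` (C `&` bdom F i)) = 0%E.
  by move=> mC C0; have /null_content_dominatesP := sfs_dominates S i; exact.
exists (bmap F i @` (Z `&` bdom F i) `|` bmap F i @` (N `&` bdom F i)); split.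
- by apply: measurableU; exact: mI.
- by rewrite (measureU0 (mI _ mZ) (mI _ mN) (I0 _ mN N0)); exact: I0.
- move=> x /= nx; apply: contrapT => /not_orP[nZ nN]; apply: nx.
  rewrite /branch_fun indicE; case: (boolP (x \in brange F i)) => [|_]; last first.
    by rewrite mul0r !mul0r.
  rewrite inE => -[y Dy yx]; have sy : sigma x = y.
    rewrite -yx; apply: contrapT => sy; apply: nN; exists y => //; split=> //.
    by apply: Nsub => /= /(_ Dy).
  congr (_ * _); rewrite sy; apply: contrapT => xy; apply: nZ; exists y => //.
  by split=> //; apply: Zsub.
Qed.

(** [branch_op] does not depend on the choice of representatives. *)
Lemma branch_opE mu F sigma i (xi : L2fun mu) : is_sfs mu F sigma ->
  branch_op F sigma i (\pi_(L2 mu) xi) =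
  \pi_(L2 mu) (insubd 0 (branch_fun mu F sigma i xi)).
Proof.
move=> S; have /eqP/L2_eqP E : \pi_(L2 mu) (repr (\pi_(L2 mu) xi)) = \pi_(L2 mu) xi.
  exact: reprK.
rewrite /branch_op; set eta := repr _ in E *.
have B := branch_fun_ae i S E.
have [mr mi] := measurable_branch_fun i xi S.
have [mr' mi'] := measurable_branch_fun i eta S.
have sq (f g : X -> R[i]) : measurable_fun setT (fun x => complex.Re (g x)) ->
    measurable_fun setT (fun x => complex.Im (g x)) ->
    {ae mu, forall x, f x = g x} -> f \in sqint mu -> g \in sqint mu.
  move=> gr gi fg /asboolP[fr fi fin]; apply/asboolP; split=> //.
  have mn (h : X -> R[i]) : measurable_fun setT (fun x => complex.Re (h x)) ->
      measurable_fun setT (fun x => complex.Im (h x)) ->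
      measurable_fun setT (fun x => (Normc.normc (h x) ^+ 2)%:E).
    move=> hr hi; apply/measurable_EFinP.
    rewrite (_ : (fun _ => _) = (fun x => complex.Re (h x) ^+ 2 + complex.Im (h x) ^+ 2)).
      by apply: measurable_funD; exact: measurable_funX.
    by apply/funext => x; case: (h x) => a b /=; rewrite sqr_sqrtr// addr_ge0// sqr_ge0.
  suff -> : (\int[mu]_x (Normc.normc (g x) ^+ 2)%:E =
    \int[mu]_x (Normc.normc (f x) ^+ 2)%:E)%E by [].
  apply: ae_eq_integral => //; [exact: mn|exact: mn|].
  by apply: filterS fg => x -> _.
have sqE : (branch_fun mu F sigma i eta \in sqint mu) =
           (branch_fun mu F sigma i xi \in sqint mu).
  apply/idP/idP; apply: sq => //.
  by apply: filterS B => x ->.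
apply/eqP/L2_eqP; case: (boolP (branch_fun mu F sigma i xi \in sqint mu)) => h.
  have h' := h; rewrite -sqE in h'.
  have v (f : X -> R[i]) : f \in sqint mu -> (insubd 0 f : L2fun mu) = f :> (X -> R[i]).
    by move=> hf; exact: (insubdK 0 hf).
  by rewrite (v _ h) (v _ h').
have h' := h; rewrite -sqE in h'.
by rewrite /insubd !insubN//; exact: nearW.
Qed.

End SemibranchingFunctionSystem.

Arguments branch_op {R d X L} mu F sigma i u.

(* Main.v *)
(** A change of variables [sigma_i] or a change of measure gives a weighted
    composition operator [xi |-> w * (xi \o phi)], which is a partial isometry
    adjoint to the weighted composition operator of the inverse substitution.
    The operators [T_i(mu)] are of this kind, with initial and final projections
    the multiplications by the indicators of [D_i] and [R_i]; the Cuntz-Krieger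
    relations are then the a.e. identities [sum_i 1_(R_i) = 1] and
    [1_(D_i) = sum_(j in Lam i) 1_(R_j)].

    With [g = dm'/dm], multiplication by [sqrt g] is a unitary from [L2 m'] to
    [L2 m]. It intertwines [T_i(m')] and [T_i(m)] because of the chain rule
    [g (sigma_i y) * rho_m y = g y * rho_m' y] for a.e. [y] in [D_i]. *)
Require Import Defs.
From mathcomp Require Import all_boot all_order all_algebra.
From mathcomp Require Import sesquilinear generic_quotient.
From mathcomp Require Import all_classical all_reals all_analysis.
From mathcomp Require Import measurable_realfun complex ring.

Set Implicit Arguments.
Unset Strict Implicit.
Unset Printing Implicit Defensive.

Import Order.TTheory GRing.Theory Num.Theory.
Import numFieldNormedType.Exports.
Import ComplexField.

Local Open Scope classical_set_scope.
Local Open Scope ring_scope.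
Local Open Scope complex_scope.
Local Open Scope quotient_scope.

(** * L2 classes and their representatives up to null sets *)

Section SquareIntegrableClasses.
Context {R : realType} d {X : measurableType d}.
Variable mu : {measure set X -> \bar R}.
Implicit Types (u v : L2 mu) (f g : X -> R[i]).

(** [f] represents the class [u], without being required to be square
    integrable or even measurable itself. *)
Definition ae_rep u f : Prop := {ae mu, forall x, repr u x = f x}.

Lemma ae_rep_repr u : ae_rep u (repr u).
Proof. exact: nearW. Qed.

Lemma ae_rep_pi (f : L2fun mu) : ae_rep (\pi_(L2 mu) f) f.
Proof. by apply/L2_eqP/eqP; exact: reprK. Qed.

Lemma ae_rep_ae u f g :
  ae_rep u f -> {ae mu, forall x, f x = g x} -> ae_rep u g.
Proof. by move=> uf fg; apply: filterS2 uf fg => x ->. Qed.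

Lemma ae_rep_eq u v f g : ae_rep u f -> ae_rep v g ->
  {ae mu, forall x, f x = g x} -> u = v.
Proof.
move=> uf vg fg; rewrite -[u]reprK -[v]reprK; apply/eqP/L2_eqP.
by apply: filterS3 uf vg fg => x -> ->.
Qed.

Lemma ae_rep_linear a u v f g : ae_rep u f -> ae_rep v g ->
  ae_rep (a *: u + v) (fun x => a * f x + g x).
Proof.
move=> uf vg; rewrite -{1}[u]reprK -{1}[v]reprK pi_L2Z pi_L2D.
have := ae_rep_pi (a *: repr u + repr v).
apply: filterS3 uf vg => x uf vg ->.
by rewrite l2valD l2valZ uf vg.
Qed.

Lemma ae_rep0 : ae_rep 0 (fun=> 0).
Proof.
rewrite (_ : 0 = \pi_(L2 mu) 0); last by rewrite piE.
exact: ae_rep_pi.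
Qed.

Lemma ae_repZ a u f : ae_rep u f -> ae_rep (a *: u) (fun x => a * f x).
Proof.
move=> uf; rewrite -[a *: u]addr0.
by apply: ae_rep_ae (ae_rep_linear a uf ae_rep0) (nearW _ _) => x; rewrite addr0.
Qed.

Lemma ae_rep_sum (I : Type) (s : seq I) (u : I -> L2 mu) (f : I -> X -> R[i]) :
  (forall i, ae_rep (u i) (f i)) ->
  ae_rep (\sum_(i <- s) u i) (fun x => \sum_(i <- s) f i x).
Proof.
move=> uf; elim: s => [|i s IH].
  by rewrite big_nil; apply: ae_rep_ae ae_rep0 (nearW _ _) => x; rewrite big_nil.
rewrite big_cons -[u i]scale1r.
apply: ae_rep_ae (ae_rep_linear 1 (uf i) IH) (nearW _ _) => x.
by rewrite mul1r big_cons.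
Qed.

End SquareIntegrableClasses.

(** * Weighted composition operators between L2 spaces *)

Section WeightedComposition.
Context {R : realType} d d' {X : measurableType d} {Y : measurableType d'}.
Variables (mu : {measure set X -> \bar R}) (nu : {measure set Y -> \bar R}).

Definition wcomp (w : Y -> R) (phi : Y -> X) (xi : X -> R[i]) (y : Y) : R[i] :=
  (w y)%:C * xi (phi y).

(** Change of variables in the form that makes [wcomp w phi] a partial isometry
    with initial space the functions supported by [E]. *)
Definition wtransfer (E : set X) (w : Y -> R) (phi : Y -> X) : Prop :=
  forall f : X -> \bar R, measurable_fun setT f -> (forall x, 0 <= f x)%E ->
    (\int[nu]_y ((w y ^+ 2)%:E * f (phi y)) = \int[mu]_(x in E) f x)%E.

(** Same shape as [branch_op], so that [branch_op] unfolds to an instance of it. The junk value 0 is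
    never taken under the hypotheses below, by [wcomp_sqint]. *)
Definition wcomp_op (w : Y -> R) (phi : Y -> X) (u : L2 mu) : L2 nu :=
  \pi_(L2 nu) (insubd 0 (wcomp w phi (repr u))).

Variables (E : set X) (w : Y -> R) (phi : Y -> X).
Hypotheses (mE : measurable E) (mw : measurable_fun setT w)
  (mphi : measurable_fun setT phi) (T : wtransfer E w phi).

Let mw2 : measurable_fun setT (fun y => (w y ^+ 2)%:E).
Proof. by apply/measurable_EFinP; exact: measurable_funX. Qed.

(** Transferring the indicator of a null set [N] gives a zero integral of [w ^+ 2 * (\1_N \o phi)],
    so [phi] avoids [N] almost everywhere that [w] is nonzero. This is what makes weighted
    composition well defined on classes. *)
Lemma wtransfer_ae (P : X -> Prop) : {ae mu, forall x, P x} ->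
  {ae nu, forall y, w y != 0 -> P (phi y)}.
Proof.
move=> [N [mN N0 NP]].
have m1 : measurable_fun setT (fun y => ((w y ^+ 2)%:E * (\1_N (phi y))%:E)%E).
  apply: emeasurable_funM => //; apply/measurable_EFinP.
  exact: (measurableT_comp (measurable_indic mN) mphi).
have : (\int[nu]_y `|(w y ^+ 2)%:E * (\1_N (phi y))%:E| = 0)%E.
  under eq_integral do rewrite gee0_abs ?mule_ge0 ?lee_fin ?sqr_ge0//.
  rewrite (T (f := fun x => (\1_N x)%:E)); last 2 first.
  - by apply/measurable_EFinP; exact: measurable_indic.
  - by move=> x; rewrite lee_fin.
  rewrite integral_indic//; apply: subset_measure0 N0 => //.
  exact: measurableI.
move=> /(ae_eq_integral_abs nu measurableT m1).
apply: filterS => y /(_ I) /= wN w0; apply: contrapT => nP.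
have {}nP : N (phi y) by apply: NP.
move: wN; rewrite indicE mem_set//= mule1 => -[] /eqP.
by rewrite expf_eq0/= (negbTE w0).
Qed.

(** Multiplication by the nonnegative factor [w ^+ 2] commutes with taking positive and negative
    parts, and the integral is the difference of the integrals of these parts. *)
Lemma wtransfer_signed (f : X -> \bar R) : measurable_fun setT f ->
  (\int[nu]_y ((w y ^+ 2)%:E * f (phi y)) = \int[mu]_(x in E) f x)%E.
Proof.
move=> mf; rewrite integralE [RHS]integralE; congr (_ - _)%E.
- rewrite -(T (measurable_funepos mf) (funepos_ge0 _)).
  apply: eq_integral => y _; rewrite !funeposE.
  by rewrite -[X in maxe _ X](mule0 (w y ^+ 2)%:E) maxe_pMr// ?lee_fin ?sqr_ge0.
- rewrite -(T (measurable_funeneg mf) (funeneg_ge0 _)).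
  apply: eq_integral => y _; rewrite !funenegE -muleN.
  by rewrite -[X in maxe _ X](mule0 (w y ^+ 2)%:E) maxe_pMr// ?lee_fin ?sqr_ge0.
Qed.

Lemma normc_sqr (z : R[i]) :
  Normc.normc z ^+ 2 = complex.Re z ^+ 2 + complex.Im z ^+ 2.
Proof. by case: z => a b /=; rewrite sqr_sqrtr// addr_ge0// sqr_ge0. Qed.

(** The change of variables turns the integral of the squared modulus into that of [xi] over [E],
    which is at most the one over the whole space. *)
Lemma wcomp_sqint (xi : L2fun mu) : wcomp w phi xi \in sqint nu.
Proof.
have /asboolP[mr mi fi] := l2valP xi.
apply/asboolP; split.
- rewrite (_ : (fun _ => _) = (fun y => w y * complex.Re (xi (phi y)))).
    by apply: measurable_funM => //; exact: (measurableT_comp mr mphi).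
  by apply/funext => y; rewrite /wcomp; case: (l2val xi _) => a b /=; ring.
- rewrite (_ : (fun _ => _) = (fun y => w y * complex.Im (xi (phi y)))).
    by apply: measurable_funM => //; exact: (measurableT_comp mi mphi).
  by apply/funext => y; rewrite /wcomp; case: (l2val xi _) => a b /=; ring.
- have m2 : measurable_fun setT (fun x => (Normc.normc (xi x) ^+ 2)%:E).
    apply/measurable_EFinP; under eq_fun do rewrite normc_sqr.
    by apply: measurable_funD; exact: measurable_funX.
  rewrite (_ : (\int[nu]_y _)%E =
    (\int[nu]_y ((w y ^+ 2)%:E * (Normc.normc (xi (phi y)) ^+ 2)%:E))%E); last first.
    apply: eq_integral => y _; rewrite -EFinM; congr EFin.
    by rewrite !normc_sqr /wcomp; case: (l2val xi _) => a b /=; ring.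
  rewrite (T m2); last by move=> x; rewrite lee_fin sqr_ge0.
  apply: le_lt_trans fi; apply: ge0_subset_integral => //.
  by move=> x _; rewrite lee_fin sqr_ge0.
Qed.

(** Where [w] vanishes both functions are 0; elsewhere [wtransfer_ae] applies. Identities between
    operators thus reduce to pointwise identities between arbitrary representatives. *)
Lemma ae_rep_wcomp u f : ae_rep u f ->
  ae_rep (wcomp_op w phi u) (wcomp w phi f).
Proof.
move=> uf; apply: ae_rep_ae (ae_rep_pi _) _.
rewrite (_ : l2val _ = wcomp w phi (repr u)); last first.
  exact: (insubdK 0 (wcomp_sqint (repr u))).
move/wtransfer_ae : uf; apply: filterS => y wu; rewrite /wcomp.
by have [->|/wu ->//] := eqVneq (w y) 0; rewrite !mul0r.
Qed.

Lemma wcomp_op_linear : linear (wcomp_op w phi).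
Proof.
move=> a u v; have ru := ae_rep_repr u; have rv := ae_rep_repr v.
apply: ae_rep_eq (ae_rep_wcomp (ae_rep_linear a ru rv))
  (ae_rep_linear a (ae_rep_wcomp ru) (ae_rep_wcomp rv)) (nearW _ _) => y.
by rewrite /wcomp mulrDr mulrCA.
Qed.

End WeightedComposition.

(** * Adjoint pairs of weighted composition operators *)

Section WeightedPairs.
Context {R : realType} d d' {X : measurableType d} {Y : measurableType d'}.

(** [wcomp w phi] and [wcomp v psi] are mutually adjoint partial isometries
    between the functions supported by [E] and those supported by [G]. *)
Record wpair (mu : {measure set X -> \bar R}) (nu : {measure set Y -> \bar R})
    (E : set X) (G : set Y) (w : Y -> R) (phi : Y -> X)
    (v : X -> R) (psi : X -> Y) : Prop := WPair {
  wpair_mE : measurable E;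
  wpair_mG : measurable G;
  wpair_mw : measurable_fun setT w;
  wpair_mphi : measurable_fun setT phi;
  wpair_mv : measurable_fun setT v;
  wpair_mpsi : measurable_fun setT psi;
  wpair_transfer : wtransfer mu nu E w phi;
  wpair_transferC : wtransfer nu mu G v psi;
  wpair_in : {ae nu, forall y, G y -> psi (phi y) = y /\ w y * v (phi y) = 1};
  wpair_out : {ae nu, forall y, ~ G y -> w y = 0};
  wpair_inC : {ae mu, forall x, E x -> phi (psi x) = x /\ v x * w (psi x) = 1};
  wpair_outC : {ae mu, forall x, ~ E x -> v x = 0}
}.

End WeightedPairs.

Lemma wpair_sym (R : realType) d d' (X : measurableType d) (Y : measurableType d')
    (mu : {measure set X -> \bar R}) (nu : {measure set Y -> \bar R})
    E G w phi v psi :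
  wpair mu nu E G w phi v psi -> wpair nu mu G E v psi w phi.
Proof. by case=> *; split. Qed.

(** The pointwise form of adjointness, used with [r] and [s] the two mutually inverse weights at
    corresponding points. *)
Lemma mulc_conj_inv (R : realType) (r s : R) (z t : R[i]) : r * s = 1 ->
  r%:C * z * t^* = (r ^+ 2)%:C * (z * (s%:C * t)^*).
Proof.
move=> rs; have -> : Num.conj (s%:C * t) = s%:C * Num.conj t.
  by case: t => x y /=; congr (_ +i* _); ring.
transitivity ((r * (r * s))%:C * (z * t^*)); first by rewrite rs mulr1 mulrA.
by rewrite expr2 !rmorphM/=; ring.
Qed.

Section WeightedPairTheory.
Context {R : realType} d d' {X : measurableType d} {Y : measurableType d'}.
Variables (mu : {measure set X -> \bar R}) (nu : {measure set Y -> \bar R}).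
Variables (E : set X) (G : set Y) (w : Y -> R) (phi : Y -> X)
  (v : X -> R) (psi : X -> Y).

(** Applying the change of variables for [psi] to [w ^+ 2 * (h \o phi)] gives
    the one for [phi]. *)
Lemma mk_wpair : measurable E -> measurable G ->
  measurable_fun setT w -> measurable_fun setT phi ->
  measurable_fun setT v -> measurable_fun setT psi ->
  wtransfer nu mu G v psi ->
  {ae nu, forall y, G y -> psi (phi y) = y /\ w y * v (phi y) = 1} ->
  {ae nu, forall y, ~ G y -> w y = 0} ->
  {ae mu, forall x, E x -> phi (psi x) = x /\ v x * w (psi x) = 1} ->
  {ae mu, forall x, ~ E x -> v x = 0} ->
  wpair mu nu E G w phi v psi.
Proof.
move=> mE mG mw mphi mv mpsi T Gin Gout Ein Eout; split => // h mh h0.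
have mwh : measurable_fun setT (fun y => ((w y ^+ 2)%:E * h (phi y))%E).
  apply: emeasurable_funM; last exact: (measurableT_comp mh mphi).
  by apply/measurable_EFinP; exact: measurable_funX.
have mvh : measurable_fun setT
    (fun x => ((v x ^+ 2)%:E * ((w (psi x) ^+ 2)%:E * h (phi (psi x))))%E).
  apply: emeasurable_funM; last exact: (measurableT_comp mwh mpsi).
  by apply/measurable_EFinP; exact: measurable_funX.
transitivity (\int[nu]_(y in G) ((w y ^+ 2)%:E * h (phi y)))%E.
  rewrite [RHS]integral_mkcond; apply: ae_eq_integral => //.
    by apply/(measurable_restrictT _ mG)/measurable_funTS.
  apply: filterS Gout => y /= w0 _; rewrite patchE; case: ifPn => // /negP yG.
  by rewrite w0 ?expr0n ?mul0e// => Gy; apply: yG; rewrite inE.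
rewrite -(T _ mwh); last by move=> y; rewrite mule_ge0// lee_fin sqr_ge0.
rewrite [RHS]integral_mkcond; apply: ae_eq_integral => //.
  by apply/(measurable_restrictT _ mE)/measurable_funTS.
apply: filterS2 Ein Eout => x /= Ein Eout _; rewrite patchE; case: ifPn.
  rewrite inE => /Ein[-> vw]; rewrite muleA -EFinM -exprMn vw expr1n.
  by rewrite mul1e.
by move=> /negP xE; rewrite Eout ?expr0n ?mul0e// => Ex; apply: xE; rewrite inE.
Qed.

Hypothesis P : wpair mu nu E G w phi v psi.
Let W := wcomp_op nu w phi : L2 mu -> L2 nu.
Let V := wcomp_op mu v psi : L2 nu -> L2 mu.

Lemma ae_rep_wpair u f : ae_rep u f -> ae_rep (W u) (wcomp w phi f).
Proof. by case: P => *; apply: ae_rep_wcomp; eassumption. Qed.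

Lemma ae_rep_wpairC u f : ae_rep u f -> ae_rep (V u) (wcomp v psi f).
Proof. by case: P => *; apply: ae_rep_wcomp; eassumption. Qed.

Lemma wpair_linear : linear W.
Proof. by case: P => *; apply: wcomp_op_linear; eassumption. Qed.

(** On [E] the two substitutions and the two weights cancel; off [E] the weight [v] vanishes. So
    [V \o W] is the projection onto the functions supported by [E]. *)
Lemma ae_rep_wpair_initial u f : ae_rep u f ->
  ae_rep (V (W u)) (fun x => (\1_E x)%:C * f x).
Proof.
move=> uf; apply: ae_rep_ae (ae_rep_wpairC (ae_rep_wpair uf)) _.
apply: filterS2 (wpair_inC P) (wpair_outC P) => x Ein Eout.
rewrite /wcomp mulrA -rmorphM indicE; have [|nE] := boolP (x \in E).
  by rewrite inE => /Ein[-> ->].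
rewrite Eout ?mul0r// => Ex.
by move/negP : nE; apply; rewrite inE.
Qed.

(** On [G] the left integrand is [w ^+ 2] times the right integrand composed with [phi], and off [G]
    it vanishes. The change of variables then gives the right integral over [E], off which [v],
    hence [V b], vanishes. *)
Lemma wpair_adjoint a b : l2dot nu (W a) b = l2dot mu a (V b).
Proof.
have [mE mG mw mphi mv mpsi T TC Gin Gout Ein Eout] := P.
have sa := wcomp_sqint mE mw mphi T (repr a).
have sb := wcomp_sqint mG mv mpsi TC (repr b).
pose a' : L2fun nu := MkL2fun sa; pose b' : L2fun mu := MkL2fun sb.
have Wa : {ae nu, forall y, repr (W a) y = a' y}.
  exact: ae_rep_wpair (ae_rep_repr a).
have Vb : {ae mu, forall x, repr (V b) x = b' x}.
  exact: ae_rep_wpairC (ae_rep_repr b).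
have [lE rE] : l2dot nu (W a) b = cdot nu a' (repr b) /\
    l2dot mu a (V b) = cdot mu (repr a) b'.
  by split; apply: eq_cdot => //; exact: nearW.
rewrite lE rE; have [ir ii] := l2_integrable a' (repr b).
have [ir' ii'] := l2_integrable (repr a) b'.
(* [F] stands for the real or the imaginary part; homogeneity under real scalars lets the weight
   pass through it. *)
have key (F : R[i] -> R) : (forall (r : R) z, F (r%:C * z) = r * F z) ->
    measurable_fun setT (EFin \o (fun y => F (a' y * (repr b y)^* ))) ->
    measurable_fun setT (EFin \o (fun x => F (repr a x * (b' x)^* ))) ->
    (\int[nu]_y (F (a' y * (repr b y)^* ))%:E =
     \int[mu]_x (F (repr a x * (b' x)^* ))%:E)%E.
  move=> FM m1 m2; have F0 : F 0 = 0.
    by have := FM 0 0; rewrite mulr0 mul0r.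
  transitivity (\int[mu]_(x in E) (F (repr a x * (b' x)^* ))%:E)%E.
    rewrite -(wtransfer_signed T m2); apply: ae_eq_integral => //.
      apply: emeasurable_funM; last exact: (measurableT_comp m2 mphi).
      by apply/measurable_EFinP; exact: measurable_funX.
    apply: filterS2 Gin Gout => y Gin Gout _ /=; rewrite -EFinM -FM; congr (F _)%:E.
    rewrite /wcomp; have [/Gin[-> wv]|/Gout ->] := pselect (G y); last first.
      by rewrite expr0n/= !mul0r.
    exact: mulc_conj_inv.
  rewrite integral_mkcond; apply: ae_eq_integral => //.
    by apply/(measurable_restrictT _ mE)/measurable_funTS.
  apply: filterS Eout => x /= Eout _; rewrite patchE; case: ifPn => // /negP xE.
  rewrite /wcomp Eout ?mul0r ?rmorph0 ?mulr0 ?F0// => Ex.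
  by apply: xE; rewrite inE.
rewrite /cdot /Rintegral; congr (fine _ +i* fine _).
- apply: key; [|exact: measurable_int ir|exact: measurable_int ir'].
  by move=> r [x y] /=; ring.
- apply: key; [|exact: measurable_int ii|exact: measurable_int ii'].
  by move=> r [x y] /=; ring.
Qed.

End WeightedPairTheory.

Section WeightedPairOperators.
Context {R : realType} d d' {X : measurableType d} {Y : measurableType d'}.
Variables (mu : {measure set X -> \bar R}) (nu : {measure set Y -> \bar R}).
Variables (E : set X) (G : set Y) (w : Y -> R) (phi : Y -> X)
  (v : X -> R) (psi : X -> Y).
Hypothesis P : wpair mu nu E G w phi v psi.
Let W := wcomp_op nu w phi : L2 mu -> L2 nu.
Let V := wcomp_op mu v psi : L2 nu -> L2 mu.

(** By symmetry [W \o V] is multiplication by the indicator of [G], and [W u] already vanishes off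
    [G]. *)
Lemma wpair_partial_isometry u : W (V (W u)) = W u.
Proof.
have ru := ae_rep_wpair P (ae_rep_repr u).
apply: ae_rep_eq (ae_rep_wpair_initial (wpair_sym P) ru) ru _.
apply: filterS (wpair_out P) => y out; rewrite /wcomp indicE.
have [|nG] := boolP (y \in G); first by rewrite mul1r.
by rewrite out ?mul0r ?mulr0// => Gy; move/negP : nG; apply; rewrite inE.
Qed.

(** With [q = u - V (W u)] in the kernel of [W], hence orthogonal to the range of [V], the
    difference of the two sides is the inner product of [u] with [q], which equals that of [q] with
    itself. *)
Lemma wpair_contraction u : l2dot nu (W u) (W u) <= l2dot mu u u.
Proof.
pose q := u - V (W u).
have Wq : W q = 0.
  rewrite /q addrC -scaleN1r [LHS](wpair_linear P) -/W.
  by rewrite wpair_partial_isometry scaleN1r addNr.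
have Pq : l2dot mu (V (W u)) q = 0.
  by rewrite (wpair_adjoint (wpair_sym P)) -/W Wq linear0r.
rewrite (wpair_adjoint P) -/V -subr_ge0 -linearBr/= -/q.
suff -> : l2dot mu u q = l2dot mu q q by exact: dnorm_ge0.
by rewrite [in RHS]/q linearBl/= Pq subr0.
Qed.

End WeightedPairOperators.

(** * Integration along a branch *)

Section Branches.
Context {R : realType} d {X : measurableType d} {L : finType}.
Implicit Types (mu : probability X R) (sigma : X -> X).
Variables (F : branch_maps X L) (i : L).
Local Notation D := (bdom F i).
Local Notation Rg := (brange F i).

Lemma measurable_brange : measurable Rg.
Proof. by apply: measurable_bimage => //; exact: measurable_bdom. Qed.

(** [bmap F i] need not be measurable off its domain. *)
Definition bext (x : X) : X := if x \in D then bmap F i x else x.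

Lemma bextE x : D x -> bext x = bmap F i x.
Proof. by move=> Dx; rewrite /bext mem_set. Qed.

Lemma measurable_bext : measurable_fun setT bext.
Proof.
have mD := measurable_bdom F i; rewrite -(setUv D).
apply/measurable_funU => //; first exact: measurableC.
split.
- apply: (eq_measurable_fun (bmap F i)); last exact: measurable_bmap.
  by move=> x; rewrite inE => /bextE.
- apply: (eq_measurable_fun id); last exact: measurable_id.
  by move=> x; rewrite inE /bext; case: ifPn => //; rewrite inE.
Qed.

Lemma branch_measureS mu (A : set X) : A `<=` D ->
  branch_measure mu F i A = mu (bmap F i @` A).
Proof. by move=> AD; rewrite /branch_measure setIidl. Qed.

(** On subsets of the image of [A], the pushforward of the branch measure along [bext] coincides
    with [mu]. *)
Lemma integral_branch_measure mu (A : set X) (f : X -> \bar R) :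
  measurable A -> A `<=` D -> measurable_fun setT f -> (forall x, 0 <= f x)%E ->
  (\int[branch_measure mu F i]_(x in A) f (bext x) =
   \int[mu]_(x in bmap F i @` A) f x)%E.
Proof.
move=> mA AD mf f0; have mD := measurable_bdom F i.
set B := bmap F i @` A; have mB : measurable B by exact: measurable_bimage.
have mpB : measurable (bext @^-1` B).
  by rewrite -[X in measurable X]setTI; exact: measurable_bext.
have pB (C : set X) : C `<=` B -> bmap F i @` (bext @^-1` C `&` D) = C.
  move=> CB; apply/seteqP; split=> [_ [y [Cy Dy] <-]|x Cx].
    by rewrite -bextE.
  have [y Ay yx] := CB _ Cx; exists y => //; split; last exact: AD.
  by rewrite /= bextE ?yx//; exact: AD.
(* Off [D] the map [bext] is the identity and may land in [B]; such points are discarded because the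
   branch measure does not charge the complement of [D]. *)
have pBA : bext @^-1` B `\` ~` D = A.
  apply/seteqP; split=> [y [] [z Az zy] /contrapT Dy|y Ay].
    rewrite (_ : y = z)//; apply: (@bmap_inj _ _ _ F i); rewrite ?inE//.
      exact: AD.
    by rewrite zy bextE.
  split; first by exists y => //; rewrite bextE//; exact: AD.
  by apply; exact: AD.
transitivity (\int[pushforward (branch_measure mu F i) bext]_(x in B) f x)%E.
  rewrite (ge0_integral_pushforward measurable_bext)//; last exact: measurable_funTS.
  rewrite (@ge0_negligible_integral _ _ _ _ _ (~` D))//.
  - by rewrite pBA.
  - exact: measurableC.
  - by apply: measurable_funTS; exact: (measurableT_comp mf measurable_bext).
  - by move=> x _; exact: f0.
  - by rewrite /= /branch_measure setICl image_set0 measure0.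
apply: eq_measure_integral; first exact: measurable_bext.
by move=> mb C mC CB; exact: (congr1 mu (pB C CB)).
Qed.

(** The exceptional set is the image of a null part of [D], which is null by domination. This
    reduces almost everywhere statements on the range to points [bmap F i y]. *)
Lemma ae_brange mu (P : X -> Prop) : branch_measure mu F i `<< mu ->
  {ae mu, forall y, D y -> P y} ->
  {ae mu, forall x, Rg x -> exists2 y, D y /\ bmap F i y = x & P y}.
Proof.
move=> /null_content_dominatesP bmu [N [mN N0 NP]].
have mND : measurable (N `&` D) by apply: measurableI => //; exact: measurable_bdom.
exists (bmap F i @` (N `&` D)); split.
- by apply: measurable_bimage => //; exact: subIsetr.
- by have := bmu _ mN N0.
- move=> x /= nP; apply: contrapT => xN; apply: nP => -[y Dy yx].
  exists y => //; apply: contrapT => nP; apply: xN; exists y => //.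
  by split => //; apply: NP => /=; tauto.
Qed.

End Branches.

(** * Real-valued nonnegative Radon-Nikodym densities *)

Section RadonNikodym.
Context {R : realType} d {X : measurableType d}.
Variables (nu : {finite_measure set X -> \bar R})
  (mu : {sigma_finite_measure set X -> \bar R}).
Hypothesis numu : nu `<< mu.

(** The nonnegative version of the density provides changes of variables for
    nonnegative functions, integrable or not. *)
Definition rn_deriv : X -> R := fine \o Radon_Nikodym_SigmaFinite.f nu mu.

Lemma rn_deriv_ge0 x : 0 <= rn_deriv x.
Proof. exact: fine_ge0 (Radon_Nikodym_SigmaFinite.f_ge0 numu x). Qed.

Lemma measurable_rn_deriv : measurable_fun setT rn_deriv.
Proof.
apply: measurableT_comp => //.
exact: measurable_int (Radon_Nikodym_SigmaFinite.f_integrable numu).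
Qed.

Lemma rn_deriv_integral (A : set X) : measurable A ->
  nu A = (\int[mu]_(x in A) (rn_deriv x)%:E)%E.
Proof.
move=> mA; rewrite (Radon_Nikodym_SigmaFinite.f_integral numu mA).
apply: eq_integral => x _; rewrite fineK//.
exact: Radon_Nikodym_SigmaFinite.f_fin_num.
Qed.

Lemma rn_deriv_change (A : set X) (f : X -> \bar R) : measurable A ->
  measurable_fun setT f -> (forall x, 0 <= f x)%E ->
  (\int[mu]_(x in A) ((rn_deriv x)%:E * f x) = \int[nu]_(x in A) f x)%E.
Proof.
move=> mA mf f0.
rewrite -(Radon_Nikodym_SigmaFinite.change_of_variables numu f0 mA); last first.
  exact: measurable_funTS.
apply: eq_integral => x _; rewrite muleC fineK//.
exact: Radon_Nikodym_SigmaFinite.f_fin_num.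
Qed.

(** Links [rn_deriv] to the version of the derivative through which [branch_density] is defined. *)
Lemma rn_derivE : {ae mu, forall x,
  fine (Radon_Nikodym (charge_of_finite_measure nu) mu x) = rn_deriv x}.
Proof.
have := ae_eq_Radon_Nikodym_SigmaFinite numu measurableT.
by apply: filterS => x /(_ I); rewrite /rn_deriv /= => ->.
Qed.

(** The zero set of the density is [nu]-null, its measure being the integral of 0, and therefore
    [mu]-null. *)
Lemma rn_deriv_gt0 : mu `<< nu -> {ae mu, forall x, 0 < rn_deriv x}.
Proof.
move=> /null_content_dominatesP munu.
have mZ : measurable (rn_deriv @^-1` [set 0]).
  by rewrite -[X in measurable X]setTI; apply: measurable_rn_deriv.
exists (rn_deriv @^-1` [set 0]); split => //.
- apply: munu => //; apply: etrans (rn_deriv_integral mZ) _.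
  by rewrite (eq_integral (cst 0%E)) ?integral0// => x; rewrite inE /= => ->.
- move=> x /= /negP; rewrite lt_neqAle rn_deriv_ge0 andbT negbK => /eqP.
  exact: esym.
Qed.

End RadonNikodym.

(** * The operators of a semibranching system as partial isometries *)

Section SemibranchingOperators.
Context {R : realType} d {X : measurableType d} {L : finType}.
Variables (mu : probability X R) (F : branch_maps X L) (sigma : X -> X).
Hypothesis S : is_sfs mu F sigma.
Variable i : L.
Local Notation D := (bdom F i).
Local Notation Rg := (brange F i).
Local Notation rho := (fun x => fine (branch_density mu F i x)).

Definition branch_weight (x : X) : R :=
  \1_(brange F i) x * fine (branch_density mu F i (sigma x)) `^ (- 2^-1).

(** The weight of the adjoint of [branch_op], which sends [xi] to the square root of the density
    times [xi \o bmap F i] on the domain, and to 0 elsewhere. *)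
Definition branch_coweight (x : X) : R :=
  \1_(bdom F i) x * fine (branch_density mu F i x) `^ 2^-1.

Lemma measurable_branch_density : measurable_fun setT rho.
Proof.
apply: measurableT_comp => //; apply: (measurable_int mu).
by apply: Radon_Nikodym_integrable; exact: (sfs_dominates S i).
Qed.

Lemma measurable_branch_weight : measurable_fun setT branch_weight.
Proof.
apply: measurable_funM; first exact/measurable_indic/measurable_brange.
apply: (@measurableT_comp _ _ _ _ _ _ (fun r : R => r `^ (- 2^-1))) => //.
exact: (measurableT_comp measurable_branch_density (sfs_coding_measurable S)).
Qed.

Lemma measurable_branch_coweight : measurable_fun setT branch_coweight.
Proof.
apply: measurable_funM; first exact/measurable_indic/measurable_bdom.
apply: (@measurableT_comp _ _ _ _ _ _ (fun r : R => r `^ 2^-1)) => //.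
exact: measurable_branch_density.
Qed.

Lemma branch_density_rn_deriv : {ae mu, forall x,
  fine (branch_density mu F i x) = rn_deriv (branch_measure mu F i) mu x}.
Proof. exact: rn_derivE (sfs_dominates S i). Qed.

Lemma branch_density_fine_gt0 :
  {ae mu, forall x, D x -> 0 < fine (branch_density mu F i x)}.
Proof.
apply: filterS (sfs_density_gt0 S i) => x h /h r0.
by rewrite -lte_fin fineK//; apply: Radon_Nikodym_fin_num; exact: (sfs_dominates S i).
Qed.

(** On [D] the squared coweight is almost everywhere the density of the branch measure, so its
    integral is one against that measure, hence one over the range. *)
Lemma branch_transfer : wtransfer mu mu Rg branch_coweight (bext F i).
Proof.
move=> f mf f0; have mD := measurable_bdom F i.
have bmu := sfs_dominates S i.
have mfb := measurableT_comp mf (measurable_bext F i).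
have mr : measurable_fun setT (fun x =>
    (rn_deriv (branch_measure mu F i) mu x)%:E * f (bext F i x))%E.
  by apply: emeasurable_funM => //; apply/measurable_EFinP; exact: measurable_rn_deriv.
rewrite -(integral_branch_measure mu mD (@subset_refl _ _) mf f0).
rewrite -(rn_deriv_change bmu mD mfb); last by move=> x; exact: f0.
rewrite [RHS]integral_mkcond; apply: ae_eq_integral => //.
- apply: emeasurable_funM => //; apply/measurable_EFinP/measurable_funX.
  exact: measurable_branch_coweight.
- by apply/(measurable_restrictT _ mD)/measurable_funTS.
apply: filterS branch_density_rn_deriv => x rE _.
rewrite patchE /branch_coweight indicE rE; case: ifPn => _.
  by rewrite mul1r powR12_sqrt ?sqr_sqrtr// rn_deriv_ge0.
by rewrite mul0r expr0n mul0e.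
Qed.

(** Only the change of variables along [bext] is established directly; [mk_wpair] derives the one
    along [sigma]. The conditions on the range are carried over from the domain by [ae_brange]. *)
Lemma branch_wpair :
  wpair mu mu D Rg branch_weight sigma branch_coweight (bext F i).
Proof.
have pw (r : R) : 0 < r -> r `^ (- 2^-1) * r `^ 2^-1 = 1.
  by move=> r0; rewrite powRN mulVf// gt_eqF// powR_gt0.
have h : {ae mu, forall y, D y ->
    sigma (bmap F i y) = y /\ 0 < fine (branch_density mu F i y)}.
  apply: filterS2 (sfs_coding S i) branch_density_fine_gt0 => y s r Dy.
  by split; [exact: s|exact: r].
apply: mk_wpair.
- exact: measurable_bdom.
- exact: measurable_brange.
- exact: measurable_branch_weight.
- exact: sfs_coding_measurable S.
- exact: measurable_branch_coweight.
- exact: measurable_bext.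
- exact: branch_transfer.
- apply: filterS (ae_brange (sfs_dominates S i) h) => x hx Rx.
  have [y [Dy yx] [sy ry]] := hx Rx.
  rewrite -yx in Rx *; rewrite /branch_weight /branch_coweight sy bextE//.
  by rewrite !indicE !mem_set// !mul1r pw.
- by apply: nearW => x Rx; rewrite /branch_weight indicE memNset// mul0r.
- apply: filterS h => y hy Dy; have [sy ry] := hy Dy.
  rewrite bextE// /branch_weight /branch_coweight sy !indicE !mem_set//; last by exists y.
  by rewrite !mul1r mulrC pw.
- by apply: nearW => x Dx; rewrite /branch_coweight indicE memNset// mul0r.
Qed.

End SemibranchingOperators.

(** * The Cuntz-Krieger relations *)

Lemma sfs_CK_representation (R : realType) d (X : measurableType d) (L : finType)
    (mu : probability X R) (F : branch_maps X L) (sigma : X -> X)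
    (Lam : L -> {set L}) :
  is_sfs mu F sigma -> condition_CK mu F Lam ->
  CK_representation (CK_matrix Lam) (l2dot mu) (branch_op mu F sigma).
Proof.
move=> S [_ CK]; have P i := branch_wpair S i.
pose V i : L2 mu -> L2 mu := wcomp_op mu (branch_coweight mu F i) (bext F i).
have rT i u : ae_rep (V i (branch_op mu F sigma i u))
    (fun x => (\1_(bdom F i) x)%:C * repr u x).
  exact: (ae_rep_wpair_initial (P i) (ae_rep_repr u)).
have rTC i u : ae_rep (branch_op mu F sigma i (V i u))
    (fun x => (\1_(brange F i) x)%:C * repr u x).
  exact: (ae_rep_wpair_initial (wpair_sym (P i)) (ae_rep_repr u)).
have disj : {ae mu, forall x, forall i j : L, brange F i x -> brange F j x -> i = j}.
  apply: filter_forall => i; apply: filter_forall => j.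
  have [->|ij] := eqVneq i j; first exact: nearW.
  exists (brange F i `&` brange F j); split.
  - by apply: measurableI; exact: measurable_brange.
  - exact: (sfs_disjoint S).
  - by move=> x /= /not_implyP[Ri /not_implyP[Rj _]].
have cov : {ae mu, forall x, exists i, brange F i x}.
  exists (~` \bigcup_i brange F i); split.
  - apply: measurableC; apply: fin_bigcup_measurable => // i _.
    exact: measurable_brange.
  - exact: (sfs_cover S).
  - by move=> x /= nx [i _ Ri]; apply: nx; exists i.
(* For [x] in exactly one range, a sum of indicators of ranges has a single nonzero term. With [A]
   full this gives the first relation, with [A] the row [Lam i] of the matrix the second. *)
have one i x (A : pred L) : (forall i j : L, brange F i x -> brange F j x -> i = j) ->
    brange F i x -> \sum_(j | A j) (\1_(brange F j) x)%:C = (A i)%:R :> R[i].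
  move=> dx Ri; rewrite big_mkcond/= (bigD1 i)//= big1 => [|j ji].
    by rewrite addr0 indicE mem_set//; case: (A i).
  rewrite indicE memNset ?if_same// => Rj.
  by move/eqP : ji; apply; exact: dx.
split.
  move=> i; split; first exact: (wpair_linear (P i)).
  by exists 1 => u; rewrite mul1r; exact: (wpair_contraction (P i)).
exists V; split.
- by move=> i a b; exact: (wpair_adjoint (P i)).
- by move=> i u; exact: (wpair_partial_isometry (P i)).
- move=> u; apply: ae_rep_eq (ae_rep_sum _ (fun i => rTC i u)) (ae_rep_repr u) _.
  apply: filterS2 disj cov => x dx [i Ri].
  by rewrite -mulr_suml (one i x predT dx Ri) mul1r.
- move=> i u; apply: ae_rep_eq (rT i u)
    (ae_rep_sum _ (fun j => ae_repZ (CK_matrix Lam i j)%:R (rTC j u))) _.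
  apply: filterS3 disj cov (CK i) => x dx [k Rk] Dx.
  under eq_bigr do rewrite mulrA.
  rewrite -mulr_suml; congr (_ * _).
  rewrite (eq_bigr (fun j => if CK_matrix Lam i j then (\1_(brange F j) x)%:C else 0)); last first.
    by move=> j _; case: CK_matrix; rewrite ?mul1r ?mul0r.
  rewrite -big_mkcond (one k x _ dx Rk) indicE /CK_matrix.
  have -> : (x \in bdom F i) = (k \in Lam i); last by case: (k \in _).
  apply/idP/idP; rewrite inE.
    by move=> /(proj1 Dx)[j /= jL Rj]; rewrite (dx _ _ Rk Rj).
  by move=> kL; apply: (proj2 Dx); exists k.
Qed.

(** * Passage to an equivalent measure *)

Lemma ae_and (R : realType) d (X : measurableType d)
    (mu : {measure set X -> \bar R}) (P Q : X -> Prop) :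
  {ae mu, forall x, P x} -> {ae mu, forall x, Q x} ->
  {ae mu, forall x, P x /\ Q x}.
Proof. by apply: filterS2. Qed.

Lemma ae_dominated (R : realType) d (X : measurableType d)
    (mu nu : {measure set X -> \bar R}) (P : X -> Prop) : nu `<< mu ->
  {ae mu, forall x, P x} -> {ae nu, forall x, P x}.
Proof.
move=> /null_content_dominatesP numu [N [mN N0 NP]]; exists N; split => //.
exact: numu.
Qed.

Section ChangeOfMeasure.
Context {R : realType} d {X : measurableType d} {L : finType}.
Variables (mu nu : probability X R) (F : branch_maps X L) (sigma : X -> X).
Hypotheses (munu : mu `<< nu) (numu : nu `<< mu).

(** A [nu]-null set is [mu]-null, so its image under the branch is [mu]-null and hence [nu]-null. *)
Lemma branch_measure_dominated i :
  branch_measure mu F i `<< mu -> branch_measure nu F i `<< nu.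
Proof.
move=> /null_content_dominatesP bmu; apply/null_content_dominatesP => A mA A0.
have /null_content_dominatesP mn := munu.
have /null_content_dominatesP nm := numu.
apply: nm; last by apply: bmu => //; exact: mn.
apply: measurable_bimage; last exact: subIsetr.
by apply: measurableI => //; exact: measurable_bdom.
Qed.

(** Both sides integrate over [A] to the [nu]-measure of the image of [A]. *)
Lemma branch_density_chain i : branch_measure mu F i `<< mu ->
  {ae mu, forall y, bdom F i y ->
    rn_deriv nu mu (bext F i y) * rn_deriv (branch_measure mu F i) mu y =
    rn_deriv nu mu y * rn_deriv (branch_measure nu F i) nu y}.
Proof.
move=> bmu; have bnu := branch_measure_dominated bmu.
set g := rn_deriv nu mu; set r := rn_deriv _ mu; set r' := rn_deriv _ nu.
have mD := measurable_bdom F i.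
have mg : measurable_fun setT g by exact: measurable_rn_deriv.
have mr : measurable_fun setT r by exact: measurable_rn_deriv.
have mr' : measurable_fun setT r' by exact: measurable_rn_deriv.
have mgb := measurableT_comp mg (measurable_bext F i).
have g0 x : 0 <= g x by exact: rn_deriv_ge0.
have r0 x : 0 <= r x by exact: rn_deriv_ge0.
have r'0 x : 0 <= r' x by exact: rn_deriv_ge0.
have I1 (A : set X) : measurable A -> A `<=` bdom F i ->
    (\int[mu]_(y in A) (g (bext F i y) * r y)%:E = nu (bmap F i @` A))%E.
  move=> mA AD; have mB : measurable (bmap F i @` A) by exact: measurable_bimage.
  rewrite [RHS](rn_deriv_integral numu mB).
  rewrite -(integral_branch_measure mu mA AD (f := fun x => (g x)%:E)); last 2 first.
  - exact/measurable_EFinP.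
  - by move=> x; rewrite lee_fin.
  rewrite -(rn_deriv_change bmu mA (f := fun x => (g (bext F i x))%:E)); last 2 first.
  - exact/measurable_EFinP.
  - by move=> x; rewrite lee_fin.
  by apply: eq_integral => y _; rewrite -EFinM mulrC.
have I2 (A : set X) : measurable A -> A `<=` bdom F i ->
    (\int[mu]_(y in A) (g y * r' y)%:E = nu (bmap F i @` A))%E.
  move=> mA AD; rewrite -(branch_measureS nu AD).
  rewrite [RHS](rn_deriv_integral bnu mA).
  rewrite -(rn_deriv_change numu mA (f := fun x => (r' x)%:E)).
  - by apply: eq_integral => y _; rewrite -EFinM.
  - exact/measurable_EFinP.
  - by move=> x; rewrite lee_fin.
suff : ae_eq mu (bdom F i) (fun y => (g (bext F i y) * r y)%:E)
    (fun y => (g y * r' y)%:E).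
  by apply: filterS => y h /h [].
(* Equal integrals over all measurable subsets of the domain force equality almost everywhere;
   integrability holds because the integral over the whole domain is the [nu]-measure of the range,
   at most 1. *)
apply: integral_ae_eq => //.
- apply/integrableP; split.
    by apply/measurable_funTS/measurable_EFinP; exact: measurable_funM.
  under eq_integral do rewrite gee0_abs ?lee_fin ?mulr_ge0//.
  rewrite I1//; apply: le_lt_trans (probability_le1 nu _) (ltry _).
  exact: measurable_brange.
- by apply/measurable_funTS/measurable_EFinP; exact: measurable_funM.
- by move=> A AD mA; rewrite I1// I2.
Qed.

Hypothesis S : is_sfs mu F sigma.

(** Positivity of the derivative at [bext F i y] comes from [wtransfer_ae], the coweight being
    nonzero on the domain. The chain rule then forces the density for [nu] to be positive. *)
Lemma branch_density_equivalent_measure i :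
  {ae mu, forall y, bdom F i y ->
    [/\ 0 < rn_deriv nu mu y, 0 < rn_deriv nu mu (bext F i y),
        0 < fine (branch_density mu F i y), 0 < fine (branch_density nu F i y) &
        rn_deriv nu mu (bext F i y) * fine (branch_density mu F i y) =
        rn_deriv nu mu y * fine (branch_density nu F i y)]}.
Proof.
have bmu := sfs_dominates S i; have bnu := branch_measure_dominated bmu.
have g0 := rn_deriv_gt0 numu munu.
have gb0 := wtransfer_ae (measurable_brange F i) (measurable_branch_coweight S i)
  (measurable_bext F i) (branch_transfer S i) g0.
have rE := ae_dominated munu (rn_derivE bnu).
have h := ae_and g0 gb0.
have h' := ae_and (branch_density_rn_deriv S i) rE.
have h2 := ae_and (branch_density_fine_gt0 S i)
  (branch_density_chain bmu).
apply: filterS3 h h' h2 => y [gy gby] [rmu rnu] [/[swap] + /[swap] Dy].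
move=> /(_ Dy) + /(_ Dy); rewrite -rmu -[rn_deriv _ nu y]rnu => chain r0.
have {}gby : 0 < rn_deriv nu mu (bext F i y).
  by apply: gby; rewrite /branch_coweight indicE mem_set// mul1r gt_eqF// powR_gt0.
by split => //; rewrite -(pmulr_rgt0 _ gy) -chain mulr_gt0.
Qed.

Lemma sfs_equivalent_measure : is_sfs nu F sigma.
Proof.
have /null_content_dominatesP nm := numu.
split.
- move=> i j ij; apply: nm; last exact: (sfs_disjoint S).
  by apply: measurableI; exact: measurable_brange.
- apply: nm; last exact: (sfs_cover S).
  apply: measurableC; apply: fin_bigcup_measurable => // i _.
  exact: measurable_brange.
- by move=> i; apply: branch_measure_dominated; exact: (sfs_dominates S i).
- move=> i; have := ae_dominated numu (branch_density_equivalent_measure i).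
  have bnu := branch_measure_dominated (sfs_dominates S i).
  apply: filterS => y h /h[_ _ _ + _].
  rewrite -lte_fin fineK//; exact: Radon_Nikodym_fin_num.
- exact: (sfs_coding_measurable S).
- by move=> i; apply: (ae_dominated numu); exact: (sfs_coding S i).
Qed.

Lemma condition_CK_equivalent_measure (Lam : L -> {set L}) :
  condition_CK mu F Lam -> condition_CK nu F Lam.
Proof.
move=> [sat CK]; split; last by move=> i; exact: ae_dominated numu (CK i).
have /null_content_dominatesP nm := numu; apply: nm => //.
apply: measurableC; apply: fin_bigcup_measurable => // i _.
exact: measurable_bdom.
Qed.

Definition half_density (x : X) : R := rn_deriv nu mu x `^ 2^-1.

Definition half_densityV (x : X) : R := rn_deriv nu mu x `^ (- 2^-1).

(** With both supports full, such a pair consists of mutually inverse unitaries. After [wpair_sym],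
    the only change of variables left to check is the defining property of the derivative of [nu] by
    [mu]. *)
Lemma half_density_wpair :
  wpair nu mu setT setT half_density id half_densityV id.
Proof.
have mg := measurable_rn_deriv numu.
have mpow p : measurable_fun setT (fun x => rn_deriv nu mu x `^ p).
  by apply: (@measurableT_comp _ _ _ _ _ _ (fun r : R => r `^ p)).
have hV : {ae mu, forall x, half_density x * half_densityV x = 1}.
  apply: filterS (rn_deriv_gt0 numu munu) => x g0.
  by rewrite /half_density /half_densityV powRN mulfV// gt_eqF// powR_gt0.
apply/wpair_sym/mk_wpair => //; [exact: mpow|exact: mpow| | | | |].
- move=> f mf f0; rewrite -(rn_deriv_change numu measurableT mf f0).
  apply: eq_integral => x _.
  by rewrite /half_density powR12_sqrt ?sqr_sqrtr// rn_deriv_ge0.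
- by apply: (ae_dominated numu); apply: filterS hV => x hV _; rewrite mulrC.
- by apply: nearW => x /(_ I).
- by apply: filterS hV => x.
- by apply: nearW => x /(_ I).
Qed.

(** Representatives of both sides vanish off the range; at a point [bmap F i y] of the range they
    agree by the chain rule at [y]. *)
Lemma half_density_intertwines i u :
  wcomp_op mu half_density id (branch_op nu F sigma i u) =
  branch_op mu F sigma i (wcomp_op mu half_density id u).
Proof.
have S' := sfs_equivalent_measure; have P := half_density_wpair.
apply: ae_rep_eq (ae_rep_wpair P (ae_rep_wpair (branch_wpair S' i) (ae_rep_repr u)))
  (ae_rep_wpair (branch_wpair S i) (ae_rep_wpair P (ae_rep_repr u))) _.
have h := ae_and (sfs_coding S i)
  (branch_density_equivalent_measure i).
have {}h : {ae mu, forall y, bdom F i y -> sigma (bmap F i y) = y /\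
    half_density (bext F i y) * fine (branch_density nu F i y) `^ (- 2^-1) =
    fine (branch_density mu F i y) `^ (- 2^-1) * half_density y}.
  apply: filterS h => y [s h] Dy; split; first exact: s.
  have [g0 gb0 r0 r'0 chain] := h Dy.
  rewrite /half_density !powRN [RHS]mulrC; apply/eqP.
  (* Cross-multiplied, the identity is the square root of the chain rule. *)
  rewrite eqr_div; [|by rewrite gt_eqF// powR_gt0..].
  by rewrite -!powRM ?chain// ltW.
apply: filterS (ae_brange (sfs_dominates S i) h) => x hx.
rewrite /wcomp /branch_weight indicE; have [|nR] := boolP (x \in brange F i); last first.
  by rewrite !mul0r mulr0.
rewrite inE => /hx[y [Dy yx] [sy hy]]; rewrite -{}yx sy -(bextE Dy).
by rewrite !mul1r !mulrA -!rmorphM hy.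
Qed.

End ChangeOfMeasure.

(** * Unitary equivalence of the two representations *)

Theorem proposition2p23 (R : realType) (d : measure_display)
    (X : measurableType d) (L : finType) (m m' : probability X R)
    (F : branch_maps X L) (sigma : X -> X) (Lam : L -> {set L})
    (m_non_atomic : non_atomic m)
    (sfs : is_sfs m F sigma)
    (CK : condition_CK m F Lam)
    (m_equiv : equivalent_measures m m') :
  [/\ CK_representation (CK_matrix Lam) (l2dot m)
        (branch_op m F sigma),
      CK_representation (CK_matrix Lam) (l2dot m')
        (branch_op m' F sigma) &
      unitarily_equivalent (l2dot m) (l2dot m')
        (branch_op m F sigma)
        (branch_op m' F sigma)].
Proof.
have [mm' m'm] := m_equiv.
have sfs' := sfs_equivalent_measure mm' m'm sfs.
have P := half_density_wpair mm' m'm.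
split.
- exact: sfs_CK_representation sfs CK.
- exact: sfs_CK_representation sfs' (condition_CK_equivalent_measure m'm CK).
pose U := wcomp_op m (half_density m m') id : L2 m' -> L2 m.
pose V := wcomp_op m' (half_densityV m m') id : L2 m -> L2 m'.
have setT1 (nu : {measure set X -> \bar R}) (f : X -> R[i]) :
    {ae nu, forall x, (\1_[set: X] x)%:C * f x = f x}.
  by apply: nearW => x; rewrite indicT mul1r.
(* Both composites are multiplication by the indicator of the whole space. *)
have UK : cancel U V.
  move=> u; have ru := ae_rep_repr u.
  exact: ae_rep_eq (ae_rep_wpair_initial P ru) ru (setT1 _ _).
have VK : cancel V U.
  move=> u; have ru := ae_rep_repr u.
  exact: ae_rep_eq (ae_rep_wpair_initial (wpair_sym P) ru) ru (setT1 _ _).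
exists U; split; last by move=> i u; exact: half_density_intertwines.
split; first exact: (wpair_linear P).
  (* [V] is both adjoint and inverse to [U], whence the isometry. *)
  move=> u v; apply: etrans (wpair_adjoint P u (U v)) _.
  by rewrite -/V UK.
by exists V.
Qed.
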